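(* $\mathsf{FRatMTL}$ is expressively equivalent to forward $\mathsf{Q2MSO}$ (over a finite alphabet $\Sigma$): for every $\mathsf{FRatMTL}$ formula $\varphi$ there is a time-constraint formula $\psi(t_0)$ of forward $\mathsf{Q2MSO}$ with $L(\psi)=L(\varphi)$, and for every time-constraint formula $\psi(t_0)$ of forward $\mathsf{Q2MSO}$ there is an $\mathsf{FRatMTL}$ formula $\varphi$ with $L(\varphi)=L(\psi)$.
   Context: Timed words: with $\Gamma=2^\Sigma\setminus\{\emptyset\}$, $\rho=(\sigma,\tau)$, $\sigma_i\in\Gamma$, $\tau_i\in\mathbb{R}_{\ge0}$, $\tau_1=0$, $\tau_i\le\tau_{i+1}$, $dom(\rho)=\{1,\dots,n\}$. Intervals: open/closed/half-open intervals of $\mathbb{R}_{\ge0}$ with endpoints in $\mathbb{N}\cup\{\infty\}$. $\mathsf{FRatMTL}$: $\varphi::=a\mid\mathrm{true}\mid\varphi\wedge\varphi\mid\neg\varphi\mid\varphi\,\mathsf{U}_I\varphi\mid\mathsf{FRat}_{I,\mathsf{re}(\mathsf{S})}\varphi$, $\mathsf{S}$ a finite set of formulas, $\mathsf{re}(\mathsf{S})$ a regular expression over alphabet $\mathsf{S}$. $\rho,i\models a$ iff $a\in\sigma_i$; $\rho,i\models\varphi_1\mathsf{U}_I\varphi_2$ iff $\exists j>i$: $\rho,j\models\varphi_2$, $\tau_j-\tau_i\in I$, $\rho,k\models\varphi_1$ for $i<k<j$; $\rho,i\models\mathsf{FRat}_{I,\mathsf{re}}\varphi$ iff $\exists j>i$: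 $\rho,j\models\varphi$, $\tau_j-\tau_i\in I$, and there are $\psi_k\in\mathsf{S}$ with $\rho,k\models\psi_k$ ($i<k<j$) and $\psi_{i+1}\cdots\psi_{j-1}\in L(\mathsf{re})$. $L(\varphi)=\{\rho:\rho,1\models\varphi\}$. Forward $\mathsf{QkMSO}$: first-order variables range over positions, second-order variables $T_i$ over sets of positions. For anchor $t_0$, $MSO^{t_0}$: $\phi::=t_p=t_q\mid t_p<t_q\mid Q_a(t_p)\mid T_j(t_p)\mid\phi\wedge\phi\mid\neg\phi\mid\exists t'.(t'>t_0\wedge\phi)\mid\exists T_i\phi\mid\psi(t_p)$, usual semantics ($Q_a(t)$: $a\in\sigma$ at $t$'s position), $\psi(t_p)$ a time-constraint formula. Time-constraint formula: $\psi(t_0)=\mathcal{Q}_1t_1\cdots\mathcal{Q}_jt_j\,\phi(\downarrow t_0,t_1,\dots,t_j)$ with $j<k$, $\phi\in MSO^{t_0}$ with free first-order variables among $t_0,\dots,t_j$ and no free second-order variables, $\mathcal{Q}_it_i$ being $\overline{\exists}t_i\in t_0+I_i$ or $\overline{\forall}t_i\in t_0+I_i$; $(\rho,a_0)\models\psi$ iff there exist / for all positions $a_i\ge a_0$ with $\tau_{a_i}\in\tau_{a_0}+I_i$ (nested) $\rho,(a_0,\dots,a_j)\models\phi$. $L(\psi)=\{\rho:(\rho,1)\models\psi(t_0)\}$. Forward $\mathsf{Q2MSO}$ is the case $k=2$. *)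

(* Defs.v *)
From HB Require Import structures.
From mathcomp Require Import all_boot all_order all_algebra.
From mathcomp Require Import all_classical reals.

Set Implicit Arguments.
Unset Strict Implicit.
Unset Printing Implicit Defensive.

Import Order.TTheory GRing.Theory Num.Theory.
Local Open Scope ring_scope.
Local Open Scope classical_set_scope.

(* A timed word is finite and nonempty: its domain {1, ..., n} is rendered as
   'I_(tw_last).+1 with n = tw_last.+1, so that position 1 is ord0. *)
Record timed_word (R : realType) (Sigma : finType) := TimedWord {
  tw_last : nat;
  tw_sym : 'I_tw_last.+1 -> {set Sigma};
  tw_time : 'I_tw_last.+1 -> R;
  tw_sym_neq0 : forall i, tw_sym i != finset.set0;
  tw_time_ge0 : forall i, 0 <= tw_time i;
  tw_time0 : tw_time ord0 = 0;
  tw_time_le : forall i j : 'I_tw_last.+1,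
    j = i.+1 :> nat -> tw_time i <= tw_time j
}.

Definition pos (R : realType) (Sigma : finType) (rho : timed_word R Sigma) :=
  'I_(tw_last rho).+1.

(* The boolean attached to an endpoint tells whether it belongs to the
   interval; None is the upper endpoint infinity. *)
Record nat_itv := NatItv {
  itv_lo : nat * bool;
  itv_hi : option (nat * bool)
}.

Definition itv_of (R : realType) (J : nat_itv) : interval R :=
  Interval (BSide (itv_lo J).2 (itv_lo J).1%:R)
           (if itv_hi J is Some u then BSide (~~ u.2) u.1%:R else +oo%O).

Inductive regexp (A : Type) :=
| RVoid
| REps
| RAtom (a : A)
| RAlt (r s : regexp A)
| RCat (r s : regexp A)
| RStar (r : regexp A).

Inductive re_lang (A : Type) : regexp A -> seq A -> Prop :=
| LEps : re_lang (REps A) [::]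
| LAtom a : re_lang (RAtom a) [:: a]
| LAltL r s w : re_lang r w -> re_lang (RAlt r s) w
| LAltR r s w : re_lang s w -> re_lang (RAlt r s) w
| LCat r s u v : re_lang r u -> re_lang s v -> re_lang (RCat r s) (u ++ v)
| LStar0 r : re_lang (RStar r) [::]
| LStarS r u v :
    re_lang r u -> re_lang (RStar r) v -> re_lang (RStar r) (u ++ v).

(* In FFRat J n F r phi, the finite set of formulas is enumerated by F, and r
   is a regular expression over it whose letters are indices into F. *)
Inductive fratmtl (Sigma : finType) : Type :=
| FSym (a : Sigma)
| FTrue
| FAnd (phi1 phi2 : fratmtl Sigma)
| FNot (phi : fratmtl Sigma)
| FUntil (J : nat_itv) (phi1 phi2 : fratmtl Sigma)
| FFRat (J : nat_itv) (n : nat) (F : 'I_n -> fratmtl Sigma) (r : regexp 'I_n)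
        (phi : fratmtl Sigma).

Section FRatSemantics.
Variables (R : realType) (Sigma : finType) (rho : timed_word R Sigma).

(* In the last clause, the letter number m of w is the one read at the position
   i + 1 + m. *)
Fixpoint frat_sat (phi : fratmtl Sigma) (i : pos rho) : Prop :=
  match phi with
  | FSym a => a \in tw_sym i
  | FTrue => True
  | FAnd phi1 phi2 => frat_sat phi1 i /\ frat_sat phi2 i
  | FNot phi1 => ~ frat_sat phi1 i
  | FUntil J phi1 phi2 =>
      exists j : pos rho,
        [/\ (i < j)%N, frat_sat phi2 j,
            tw_time j - tw_time i \in itv_of R J
          & forall k : pos rho, (i < k < j)%N -> frat_sat phi1 k]
  | FFRat J n F r phi1 =>
      exists j : pos rho,
        [/\ (i < j)%N, frat_sat phi1 j,
            tw_time j - tw_time i \in itv_of R J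
          & exists w : (j - i.+1)%N.-tuple 'I_n,
              (forall (k : pos rho) (m : 'I_(j - i.+1)%N),
                 k = (i.+1 + m)%N :> nat -> frat_sat (F (tnth w m)) k) /\
              re_lang r w]
  end.

End FRatSemantics.

Definition frat_lang (R : realType) (Sigma : finType) (phi : fratmtl Sigma) :
    set (timed_word R Sigma) :=
  [set rho | frat_sat (rho := rho) phi ord0].

Arguments frat_lang R {Sigma} phi _.

Inductive time_quant := TExists of nat_itv | TForall of nat_itv.

(* [mso Sigma k n m] is MSO^{t_0} with free first-order variables among
   t_0, ..., t_n and free second-order variables among T_0, ..., T_(m-1); the
   anchor t_0 is ord0.  Variables are de Bruijn levels: MExFO binds t_(n+1) and
   MExSO binds T_m.  [tcf Sigma k] is the type of time-constraint formulas
   psi(t_0) of forward QkMSO; MTime psi p is psi(t_p). *)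
Inductive mso (Sigma : finType) (k : nat) : nat -> nat -> Type :=
| MEq n m (p q : 'I_n.+1) : mso Sigma k n m
| MLt n m (p q : 'I_n.+1) : mso Sigma k n m
| MSym n m (a : Sigma) (p : 'I_n.+1) : mso Sigma k n m
| MIn n m (X : 'I_m) (p : 'I_n.+1) : mso Sigma k n m
| MAnd n m (phi1 phi2 : mso Sigma k n m) : mso Sigma k n m
| MNot n m (phi : mso Sigma k n m) : mso Sigma k n m
| MExFO n m (phi : mso Sigma k n.+1 m) : mso Sigma k n m
| MExSO n m (phi : mso Sigma k n m.+1) : mso Sigma k n m
| MTime n m (psi : tcf Sigma k) (p : 'I_n.+1) : mso Sigma k n m
with tcf (Sigma : finType) (k : nat) : Type :=
| TCF (j : nat) (ltjk : (j < k)%N) (Q : j.-tuple time_quant)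
      (phi : mso Sigma k j 0).

Section MSOSemantics.
Variables (R : realType) (Sigma : finType) (rho : timed_word R Sigma) (k : nat).

Definition in_window (a0 : pos rho) (J : nat_itv) (a : pos rho) : Prop :=
  (a0 <= a)%N /\ tw_time a - tw_time a0 \in itv_of R J.

Fixpoint prefix_sat (a0 : pos rho) (j : nat) :
    j.-tuple time_quant -> (j.-tuple (pos rho) -> Prop) -> Prop :=
  match j with
  | 0 => fun _ P => P [tuple]
  | j'.+1 => fun Q P =>
      let rest a :=
        prefix_sat a0 (behead_tuple Q) (fun s => P (cons_tuple a s)) in
      match thead Q with
      | TExists J => exists a, in_window a0 J a /\ rest a
      | TForall J => forall a, in_window a0 J a -> rest a
      end
  end.

Fixpoint mso_sat (n m : nat) (phi : mso Sigma k n m) :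
    n.+1.-tuple (pos rho) -> m.-tuple {set pos rho} -> Prop :=
  match phi in mso _ _ n m
    return n.+1.-tuple (pos rho) -> m.-tuple {set pos rho} -> Prop with
  | MEq _ _ p q => fun t _ => tnth t p = tnth t q
  | MLt _ _ p q => fun t _ => (tnth t p < tnth t q)%N
  | MSym _ _ a p => fun t _ => a \in tw_sym (tnth t p)
  | MIn _ _ X p => fun t T => tnth t p \in tnth T X
  | MAnd _ _ phi1 phi2 => fun t T => mso_sat phi1 t T /\ mso_sat phi2 t T
  | MNot _ _ phi1 => fun t T => ~ mso_sat phi1 t T
  | MExFO _ _ phi1 => fun t T => exists a : pos rho,
      (tnth t ord0 < a)%N /\ mso_sat phi1 (rcons_tuple t a) T
  | MExSO _ _ phi1 => fun t T => exists A : {set pos rho},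
      mso_sat phi1 t (rcons_tuple T A)
  | MTime _ _ psi p => fun t _ => tcf_sat psi (tnth t p)
  end
with tcf_sat (psi : tcf Sigma k) (a0 : pos rho) : Prop :=
  match psi with
  | TCF _ _ Q phi =>
      prefix_sat a0 Q (fun s => mso_sat phi (cons_tuple a0 s) [tuple])
  end.

End MSOSemantics.

Definition tcf_lang (R : realType) (Sigma : finType) (k : nat)
    (psi : tcf Sigma k) : set (timed_word R Sigma) :=
  [set rho | tcf_sat (rho := rho) psi ord0].

Arguments tcf_lang R {Sigma k} psi _.

Definition q2mso (Sigma : finType) := tcf Sigma 2.

(* Main.v *)
Require Import Defs.
From mathcomp Require Import all_boot all_order all_algebra.
From mathcomp Require Import all_classical reals.
From mathcomp Require Import zify.

Set Implicit Arguments.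
Unset Strict Implicit.
Unset Printing Implicit Defensive.

Import Order.TTheory GRing.Theory Num.Theory.

(* From the temporal logic to the second-order logic, a factor of the word
   matches a regular expression iff an MSO formula holds at its two ends, a star
   being witnessed by the set of its cut points; the anchor restriction is
   harmless, since all cut points lie after the anchor.

   Conversely, an MSO formula anchored at t_0 is a recognizable property of the
   suffix starting at t_0, over an alphabet recording the values of the
   variables and, at each position, the truth of the letters and nested
   time-constraint formulas, which inductively are temporal formulas.  When at
   most one further variable t_1 is free, the run of the automaton splits at t_0
   and t_1: the states it passes through form a finite choice, and by Kleene's
   theorem the factors between t_0 and t_1 and after t_1 are described by
   regular expressions, hence by FRat modalities. *)

Scheme mso_mutual_ind := Induction for mso Sort Prop
  with tcf_mutual_ind := Induction for tcf Sort Prop.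
Combined Scheme mso_tcf_ind from mso_mutual_ind, tcf_mutual_ind.

(** * Regular expressions and automata *)

Section RegexpInversion.
Variable A : Type.
Implicit Types (r s : regexp A) (w : seq A).

Lemma re_void w : ~ re_lang (RVoid A) w.
Proof. by move=> H; inversion H. Qed.

Lemma re_eps w : re_lang (REps A) w <-> w = [::].
Proof. by split=> [H|->]; [inversion H | constructor]. Qed.

Lemma re_atom a w : re_lang (RAtom a) w <-> w = [:: a].
Proof. by split=> [H|->]; [inversion H | constructor]. Qed.

Lemma re_alt r s w : re_lang (RAlt r s) w <-> re_lang r w \/ re_lang s w.
Proof.
split=> [H|[]]; [inversion H; subst; by [left|right] | exact: LAltL | exact: LAltR].
Qed.

Lemma re_cat r s w : re_lang (RCat r s) w <->
  exists u v, [/\ w = u ++ v, re_lang r u & re_lang s v].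
Proof.
split=> [H|[u [v [-> ru sv]]]]; last exact: LCat.
by inversion H; subst; exists u, v.
Qed.

(** The expression is generalised behind an equation before the induction, so that only the two star
    rules survive and [P] is assumed only for the remaining iterations. *)
Lemma re_star_ind r (P : seq A -> Prop) :
  P [::] -> (forall u v, re_lang r u -> re_lang (RStar r) v -> P v -> P (u ++ v)) ->
  forall w, re_lang (RStar r) w -> P w.
Proof.
move=> P0 PS w; move e: (RStar r) => r' H.
elim: H e => // r1 u v ru _ sv IHv [e].
by subst; apply: PS => //; apply: IHv.
Qed.

End RegexpInversion.

(** * Kleene's theorem, from automata to regular expressions *)

Section Kleene.
Variables (Q : finType) (A : finType) (delta : Q -> A -> Q).

(* The states visited strictly between the two ends belong to X. *)
Inductive path_through (X : seq Q) : Q -> seq A -> Q -> Prop :=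
| PathNil p : path_through X p [::] p
| PathOne p a : path_through X p [:: a] (delta p a)
| PathCons p a w q : delta p a \in X -> path_through X (delta p a) w q ->
    path_through X p (a :: w) q.

Lemma path_through_sub (X Y : seq Q) p w q : {subset X <= Y} ->
  path_through X p w q -> path_through Y p w q.
Proof.
move=> sXY; elim=> [p'|p' a|p' a v q' Xp _ IH]; try by constructor.
by constructor=> //; apply: sXY.
Qed.

Lemma path_through_cat X p u x v q : x \in X -> path_through X p u x ->
  path_through X x v q -> path_through X p (u ++ v) q.
Proof.
move=> + pu; elim: pu => [p'|p' a|p' a w y Xp _ IH] // Xx xv.
  exact: PathCons.
by apply: PathCons => //; apply: IH.
Qed.

(** McNaughton-Yamada induction on the allowed intermediate states: once [x] is allowed, a path
    either needs no stop at [x] or is a path to [x], some loops at [x], and a path from [x], each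
    through [X] only. *)
Lemma path_through_regexp X p q : exists r, forall w,
  re_lang r w <-> path_through X p w q.
Proof.
elim: X p q => [|x X IH] p q.
  (* Without intermediate states only words of length at most one remain; the letters leading from
     [p] to [q] are collected by alternation along the enumeration of [A]. *)
  have [r rP] : exists r : regexp A, forall w, re_lang r w <->
      exists2 a, a \in enum A & w = [:: a] /\ delta p a = q.
    elim: (enum A) => [|a s [r rP]].
      by exists (RVoid A) => w; split=> [/re_void|[]].
    have [e|ne] := eqVneq (delta p a) q.
      exists (RAlt (RAtom a) r) => w; rewrite re_alt re_atom rP; split.
        case=> [->|[b bs ?]]; first by exists a; rewrite ?mem_head.
        by exists b; rewrite ?in_cons ?bs ?orbT.
      move=> [b]; rewrite in_cons => /orP[/eqP -> [-> _]|bs [-> e']]; first by left.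
      by right; exists b.
    exists r => w; rewrite rP; split=> -[b bs [-> e]].
      by exists b; rewrite ?in_cons ?bs ?orbT.
    move: bs; rewrite in_cons => /orP[/eqP eb|bs]; last by exists b.
    by rewrite -eb e eqxx in ne.
  have [r' r'P] : exists r, forall w, re_lang r w <-> w = [::] :> seq A /\ p = q.
    have [->|ne] := eqVneq p q.
      by exists (REps A) => w; rewrite re_eps; split=> [|[]].
    by exists (RVoid A) => w; split=> [/re_void|[_ e]] //; rewrite e eqxx in ne.
  exists (RAlt r' r) => w; rewrite re_alt rP r'P; split.
    case=> [[-> ->]|[a _ [-> <-]]]; by constructor.
  case=> [p'|p' a|//]; first by left.
  by right; exists a => //; rewrite mem_enum.
have [r0 r0P] := IH p q; have [r1 r1P] := IH p x.
have [r2 r2P] := IH x x; have [r3 r3P] := IH x q.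
have sub : {subset X <= x :: X} by move=> y Xy; rewrite in_cons Xy orbT.
exists (RAlt r0 (RCat r1 (RCat (RStar r2) r3))) => w; rewrite re_alt; split.
  case=> [/r0P/(path_through_sub sub) //|].
  move=> /re_cat[u [v [-> /r1P pu /re_cat[v1 [v2 [-> sv1 /r3P pv2]]]]]].
  apply: (path_through_cat (mem_head x X)); first exact: path_through_sub pu.
  elim/re_star_ind: v1 / sv1 => [|u1 u2 /r2P pu1 _ pu2].
    exact: path_through_sub pv2.
  rewrite -catA; apply: (path_through_cat (mem_head x X)) pu2.
  exact: path_through_sub pu1.
suff gen p' w' q' : path_through (x :: X) p' w' q' -> path_through X p' w' q' \/
    exists u v1 v2, [/\ w' = u ++ v1 ++ v2, path_through X p' u x,
      re_lang (RStar r2) v1 & path_through X x v2 q'].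
  case/gen=> [?|[u [v1 [v2 [-> pu sv1 pv2]]]]]; first by left; apply/r0P.
  right; apply: LCat; first exact/r1P.
  by apply: LCat => //; apply/r3P.
elim=> {p' w' q'} [p'|p' a|p' a w' q' /[!in_cons] Xp _ IHw]; try by left; constructor.
case/orP: Xp => [/eqP ex|Xp]; last first.
  case: IHw => [?|[u [v1 [v2 [-> pu sv1 pv2]]]]]; first by left; apply: PathCons.
  by right; exists (a :: u), v1, v2; split=> //; apply: PathCons.
(* The first letter already reaches [x]. Either the rest needs no further stop there and the starred
   part is empty, or the initial part [u] of the rest is a loop at [x], to be put in front of the
   other loops. *)
have pa : path_through X p' [:: a] x by rewrite -ex; constructor.
rewrite ex in IHw; right.
case: IHw => [?|[u [v1 [v2 [-> pu sv1 pv2]]]]].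
  by exists [:: a], [::], w'; split=> //; constructor.
exists [:: a], (u ++ v1), v2; split=> //; first by rewrite -catA.
by apply: LStarS => //; apply/r2P.
Qed.

Lemma kleene p q : exists r, forall w, re_lang r w <-> foldl delta p w = q.
Proof.
have [r rP] := path_through_regexp (enum Q) p q.
exists r => w; rewrite rP; split; first by elim.
move=> <-; elim: w p {r rP q} => [|a w IH] p /=; first by constructor.
by apply: PathCons; rewrite ?mem_enum.
Qed.

End Kleene.

(** * Recognizable languages and their closure properties *)

Definition recognizable (B : Type) (L : seq B -> Prop) : Prop :=
  exists (Q : finType) (delta : Q -> B -> Q) (q0 : Q) (F : pred Q),
  forall w, L w <-> F (foldl delta q0 w).

Lemma foldl_map (Q B B' : Type) (d : Q -> B -> Q) (f : B' -> B) q w :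
  foldl d q (map f w) = foldl (fun p a => d p (f a)) q w.
Proof. by elim: w q => //=. Qed.

Section Recognizable.
Variable B : Type.
Implicit Types L : seq B -> Prop.

Lemma recognizable_not L : recognizable L -> recognizable (fun w => ~ L w).
Proof.
move=> [Q [d [q0 [F FP]]]]; exists Q, d, q0, (predC F) => w /=.
by rewrite FP; split=> /negP.
Qed.

Lemma recognizable_and L L' : recognizable L -> recognizable L' ->
  recognizable (fun w => L w /\ L' w).
Proof.
move=> [Q [d [q0 [F FP]]]] [Q' [d' [q0' [F' FP']]]].
exists (Q * Q')%type, (fun q a => (d q.1 a, d' q.2 a)), (q0, q0').
exists (fun q => F q.1 && F' q.2) => w; rewrite FP FP'.
have -> : foldl (fun q a => (d q.1 a, d' q.2 a)) (q0, q0') w =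
    (foldl d q0 w, foldl d' q0' w).
  by elim: w q0 q0' {FP FP'} => //= a w IH p p'; rewrite IH.
by split=> [[-> ->]|/andP].
Qed.

Lemma recognizable_map (B' : Type) (f : B' -> B) L : recognizable L ->
  recognizable (fun w => L (map f w)).
Proof.
move=> [Q [d [q0 [F FP]]]]; exists Q, (fun q a => d q (f a)), q0, F => w.
by rewrite FP foldl_map.
Qed.

(** Closure under projection, by the subset construction: a state of [D] is the set of states
    reachable under some choice of the erased track. This is what quantifiers become on the automata
    side. *)
Lemma recognizable_exists (C : finType) (L : seq (B * C) -> Prop) :
  recognizable L ->
  recognizable (fun w => exists v, size v = size w /\ L (zip w v)).
Proof.
move=> [Q [d [q0 [F FP]]]].
pose D (S : {set Q}) b := [set q' | [exists q in S, [exists c, d q (b, c) == q']]].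
have DP S w q : q \in foldl D S w <->
    exists2 p, p \in S & exists v, size v = size w /\ foldl d p (zip w v) = q.
  elim: w S => [|b w IH] S /=.
    split=> [Sq|[p Sp [[|c v] [// _ /= <-]]] //].
    by exists q => //; exists [::].
  rewrite IH; split=> [[p]|[p Sp [[|c v] [//= [sv] e]]]].
    rewrite inE => /existsP[p' /andP[Sp' /existsP[c /eqP <-]]] [v [sv e]].
    by exists p' => //; exists (c :: v); rewrite /= sv.
  exists (d p (b, c)); last by exists v.
  by rewrite inE; apply/existsP; exists p; rewrite Sp; apply/existsP; exists c.
exists {set Q}, D, [set q0], (fun S : {set Q} => [exists q in S, F q]) => w; split.
  move=> [v [sv /FP Fv]]; apply/existsP; exists (foldl d q0 (zip w v)).
  rewrite Fv andbT; apply/DP; exists q0; rewrite ?inE //.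
  by exists v.
move=> /existsP[q /andP[/DP[p /[!inE]/eqP -> [v [sv e]]] Fq]].
by exists v; split=> //; rewrite FP e.
Qed.

Lemma recognizable_has (f : pred B) : recognizable (fun w => has f w).
Proof.
exists bool, (fun q a => q || f a), false, id => w.
suff -> q : foldl (fun q a => q || f a) q w = q || has f w by [].
by elim: w q => [|a w IH] q /=; rewrite ?orbF // IH orbA.
Qed.

Fixpoint has_before (f g : pred B) (w : seq B) : bool :=
  if w is a :: w' then f a && has g w' || has_before f g w' else false.

Lemma recognizable_has_before (f g : pred B) :
  recognizable (fun w => has_before f g w).
Proof.
(* The second bit consults the first bit as it was before reading [a], so that the [g]-letter comes
   strictly after the [f]-letter. *)
pose D (q : bool * bool) a := (q.1 || f a, q.2 || q.1 && g a).
exists (bool * bool)%type, D, (false, false), snd => w.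
suff -> q : (foldl D q w).2 = q.2 || q.1 && has g w || has_before f g w by [].
elim: w q => [|a w IH] [q1 q2] /=; first by rewrite andbF !orbF.
rewrite IH /=; by case: q2 q1 (f a) (g a) (has g w) => [] [] [] [] [].
Qed.

End Recognizable.

(** * Segments of positions *)

Section RconsTuple.
Variables (T : Type) (n : nat) (t : n.-tuple T) (a : T).

Lemma tnth_rcons_widen (p : 'I_n) :
  tnth (rcons_tuple t a) (widen_ord (leqnSn n) p) = tnth t p.
Proof. by rewrite !(tnth_nth a) /= nth_rcons size_tuple ltn_ord. Qed.

Lemma tnth_rcons_max : tnth (rcons_tuple t a) ord_max = a.
Proof. by rewrite (tnth_nth a) /= nth_rcons size_tuple ltnn eqxx. Qed.

End RconsTuple.

Lemma tnth_rcons0 (T : Type) (n : nat) (t : n.+1.-tuple T) (a : T) :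
  tnth (rcons_tuple t a) ord0 = tnth t ord0.
Proof.
rewrite -(tnth_rcons_widen t a ord0); congr tnth; exact: val_inj.
Qed.

Section Positions.
Variables (R : realType) (Sigma : finType) (rho : timed_word R Sigma).

(** A half-open range. Indices past the end of the word would be sent to a default by [inord],
    whence the bound on [n] in the membership and ordering lemmas. *)
Definition positions (m n : nat) : seq (pos rho) :=
  [seq inord i | i <- iota m (n - m)].

Definition positions_from (m : nat) : seq (pos rho) :=
  positions m (tw_last rho).+1.

Lemma positions_cat m c n : m <= c <= n ->
  positions m n = positions m c ++ positions c n.
Proof.
move=> /andP[mc cn]; rewrite /positions -map_cat.
have -> : n - m = (c - m) + (n - c) by lia.
by rewrite iotaD subnKC.
Qed.

Lemma positions_cons (i : pos rho) n : i < n ->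
  positions i n = i :: positions i.+1 n.
Proof.
move=> lin; rewrite /positions.
have -> : n - i = (n - i.+1).+1 by lia.
by rewrite /= inord_val.
Qed.

Lemma mem_positions m n (i : pos rho) : n <= (tw_last rho).+1 ->
  (i \in positions m n) = (m <= i < n).
Proof.
move=> le_n; apply/mapP/idP => [[k]|/andP[mi lin]].
  rewrite mem_iota => /andP[mk kn] ->; rewrite inordK; lia.
by exists (nat_of_ord i); rewrite ?inord_val // mem_iota; lia.
Qed.

Lemma mem_positions_from m (i : pos rho) : (i \in positions_from m) = (m <= i).
Proof. by rewrite mem_positions // ltn_ord andbT. Qed.

Lemma positions_sorted m n : n <= (tw_last rho).+1 ->
  pairwise (fun i j : pos rho => i < j) (positions m n).
Proof.
move=> le_n; rewrite /positions pairwise_map.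
have := iota_ltn_sorted m (n - m); rewrite (sorted_pairwise ltn_trans).
apply: (@sub_in_pairwise _ (mem (iota m (n - m)))); last first.
  by apply/allP => i.
move=> i j; rewrite !mem_iota => /andP[mi lin] /andP[mj ljn] /= lij.
by rewrite !inordK //; lia.
Qed.

Lemma positions_from_uniq m : uniq (positions_from m).
Proof.
apply: pairwise_uniq (positions_sorted m (leqnn _)) => i; exact: ltnn.
Qed.

Lemma has_positions_from (B : Type) (e : pos rho -> B) (f : pred B) m :
  has f (map e (positions_from m)) <-> exists2 i : pos rho, m <= i & f (e i).
Proof.
rewrite has_map; split=> [/hasP[i]|[i mi fi]].
  by rewrite mem_positions_from; exists i.
by apply/hasP; exists i; rewrite // mem_positions_from.
Qed.

Lemma has_before_positions_from (B : Type) (e : pos rho -> B) (f g : pred B) m :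
  has_before f g (map e (positions_from m)) <->
  exists i j : pos rho, [/\ m <= i, i < j, f (e i) & g (e j)].
Proof.
have : forall i : pos rho, (i \in positions_from m) = (m <= i).
  exact: mem_positions_from.
have := positions_sorted m (leqnn _); rewrite -/(positions_from m).
set s := positions_from m => srt ms.
transitivity (exists i j : pos rho, [/\ i \in s, j \in s, i < j, f (e i) & g (e j)]).
  elim: s srt {ms} => [|x s IH] /=; first by split=> // -[? [? []]].
  move=> /andP[/allP xs /IH {}IH]; split.
    case/orP=> [/andP[fx]|/IH[i [j [si sj ij fi gj]]]].
      rewrite has_map => /hasP[j sj gj]; exists x, j.
      by rewrite mem_head in_cons sj orbT xs.
    by exists i, j; rewrite !in_cons si sj !orbT.
  move=> [i [j []]]; rewrite !in_cons => /predU1P[->|si] /predU1P[->|sj] ij fi gj.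
  - by rewrite ltnn in ij.
  - by apply/orP; left; rewrite fi has_map; apply/hasP; exists j.
  - by have := xs _ si; lia.
  - by apply/orP; right; apply/IH; exists i, j.
split=> -[i [j]] => [[si sj ij fi gj]|[si ij fi gj]]; exists i, j; split=> //.
- by rewrite -ms.
- by rewrite ms.
- by rewrite ms; lia.
Qed.

End Positions.

(** As [s] has no repetition, the index of [x] in [s] recovers its entry in the column [v]. A track
    guessed by an automaton is thus a function on positions. *)
Lemma exists_column (T : eqType) (s : seq T) (B C : Type) (c0 : C) (f : T -> B)
    (K : seq (B * C) -> Prop) : uniq s ->
  (exists v, size v = size (map f s) /\ K (zip (map f s) v)) <->
  exists h : T -> C, K [seq (f x, h x) | x <- s].
Proof.
move=> us; split=> [[v [sv Kv]]|[h Kh]]; last first.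
  by exists (map h s); rewrite !size_map zip_map.
rewrite size_map in sv; exists (fun x => nth c0 v (index x s)).
rewrite -zip_map; suff -> : [seq nth c0 v (index x s) | x <- s] = v by [].
case: s us sv {Kv} => [|x0 s] us sv; first by rewrite (size0nil sv).
apply: (@eq_from_nth _ c0); rewrite size_map // => i ilt.
by rewrite (nth_map x0) // index_uniq.
Qed.

(** * Predicates on positions defined by formulas of the temporal logic *)

(** The labelling condition of [FFRat] on plain sequences and natural numbers, free of the dependent
    tuple and therefore suited to induction and concatenation. *)
Fixpoint reads (A : Type) (S : A -> nat -> Prop) (w : seq A) (p : nat) : Prop :=
  if w is a :: w' then S a p /\ reads S w' p.+1 else True.

Lemma reads_onth (A : Type) (S : A -> nat -> Prop) w p :
  reads S w p <-> forall m a, onth w m = Some a -> S a (p + m).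
Proof.
elim: w p => [|b w IH] p; first by split=> // _ m a; rewrite onth0n.
rewrite /= IH; split=> [[Sb H] [|m] a /=|H].
- by move=> [<-]; rewrite addn0.
- by rewrite addnS -addSn; apply: H.
split=> [|m a ma]; first by rewrite -(addn0 p); apply: H.
by rewrite addSn -addnS; apply: H.
Qed.

Lemma frat_sat_FRat (R : realType) (Sigma : finType) (rho : timed_word R Sigma)
    J n (F : 'I_n -> fratmtl Sigma) r phi (i : pos rho) :
  frat_sat (FFRat J F r phi) i <->
  exists j : pos rho, [/\ i < j, frat_sat phi j,
    (tw_time j - tw_time i)%R \in itv_of R J &
    exists w, [/\ size w = j - i.+1,
      reads (fun a k => @frat_sat R Sigma rho (F a) (inord k)) w i.+1 & re_lang r w]].
Proof.
split=> -[j [ij sj Jj]] => [[w [wF rw]]|[w [sw wF rw]]]; exists j; split=> //.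
  exists w; split; rewrite ?size_tuple //; apply/reads_onth => m a ma.
  have lm : m < j - i.+1.
    by rewrite ltnNge; apply/negP => lem; rewrite onth_default ?size_tuple in ma.
  have /tnth_onth <- : onth w (Ordinal lm) = Some a by [].
  by apply: wF; rewrite inordK //; have := ltn_ord j; lia.
have sw' : size w == j - i.+1 by rewrite sw.
exists (Tuple sw'); split=> // k m km.
have /reads_onth/(_ m (tnth (Tuple sw') m)) := wF.
rewrite -km inord_val; apply.
by apply/(tnth_onth _ (Tuple sw')).
Qed.

Lemma tw_time_mono (R : realType) (Sigma : finType) (rho : timed_word R Sigma)
  (i j : pos rho) : i <= j -> (tw_time i <= tw_time j)%R.
Proof.
move=> ij; have [d] : exists d, j = i + d :> nat by exists (j - i); lia.
elim: d j {ij} => [|d IH] j e.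
  by have -> : j = i by apply: val_inj; rewrite /= e addn0.
have ltd : i + d < (tw_last rho).+1 by have := ltn_ord j; lia.
apply: le_trans (IH (Ordinal ltd) erefl) _.
by apply: tw_time_le; rewrite /= e addnS.
Qed.

(** Since time stamps are nondecreasing, this interval imposes nothing on later positions; it turns
    the timed modalities into untimed ones. *)
Definition itv_full : nat_itv := NatItv (0, true) None.

Lemma itv_fullP (R : realType) (x : R) : (0 <= x)%R -> x \in itv_of R itv_full.
Proof. by move=> x0; rewrite in_itv /= x0. Qed.

Section Definable.
Variables (R : realType) (Sigma : finType).
Local Notation word := (timed_word R Sigma).

Definition definable (P : forall rho : word, pos rho -> Prop) : Prop :=
  exists phi : fratmtl Sigma, forall rho i, frat_sat phi i <-> P rho i.

(** Such labellings supply the letters that automata read along a timed word. *)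
Definition definable_map (A : Type) (g : forall rho : word, pos rho -> A) : Prop :=
  forall a, definable (fun rho i => g rho i = a).

Lemma definable_iff (P P' : forall rho : word, pos rho -> Prop) :
  (forall rho i, P rho i <-> P' rho i) -> definable P -> definable P'.
Proof. by move=> e [phi phiP]; exists phi => rho i; rewrite phiP e. Qed.

Lemma definable_not P : definable P -> definable (fun rho i => ~ P rho i).
Proof. by move=> [phi phiP]; exists (FNot phi) => rho i /=; rewrite phiP. Qed.

Lemma definable_and P P' : definable P -> definable P' ->
  definable (fun rho i => P rho i /\ P' rho i).
Proof.
move=> [phi phiP] [phi' phiP'].
by exists (FAnd phi phi') => rho i /=; rewrite phiP phiP'.
Qed.

Lemma definable_or P P' : definable P -> definable P' ->
  definable (fun rho i => P rho i \/ P' rho i).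
Proof.
move=> dP dP'.
have := definable_not (definable_and (definable_not dP) (definable_not dP')).
apply: definable_iff => rho i; rewrite not_andE !notE.
by [].
Qed.

Lemma definable_const (c : Prop) : definable (fun _ _ => c).
Proof.
have [hc|hc] := EM c; first by exists (FTrue Sigma).
by exists (FNot (FTrue Sigma)) => rho i /=; split.
Qed.

Lemma definable_exists (C : finType) (P : C -> forall rho : word, pos rho -> Prop) :
  (forall c, definable (P c)) -> definable (fun rho i => exists c, P c rho i).
Proof.
move=> dP; suff: definable (fun rho i => exists2 c, c \in enum C & P c rho i).
  apply: definable_iff => rho i; split=> [[c _]|[c Pc]]; first by exists c.
  by exists c => //; rewrite mem_enum.
elim: (enum C) => [|c s IH].
  by apply: definable_iff (definable_const False) => rho i; split=> // -[].
apply: definable_iff (definable_or (dP c) IH) => rho i; split.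
  case=> [Pc|[b bs Pb]]; first by exists c; rewrite ?mem_head.
  by exists b; rewrite ?in_cons ?bs ?orbT.
by move=> [b /[!in_cons]/predU1P[->|bs] Pb]; [left | right; exists b].
Qed.

Lemma definable_map_bool P : definable P ->
  definable_map (fun rho i => `[< P rho i >]).
Proof.
move=> dP [].
  by apply: definable_iff dP => rho i; split=> [/asboolP|/asboolP].
apply: definable_iff (definable_not dP) => rho i; split.
  by move=> /asboolPn/negbTE.
by move=> /negbT/asboolPn.
Qed.

Lemma definable_map_pair (A B : Type) (g : forall rho : word, pos rho -> A)
    (h : forall rho : word, pos rho -> B) :
  definable_map g -> definable_map h ->
  definable_map (fun rho i => (g rho i, h rho i)).
Proof.
move=> dg dh [a b]; apply: definable_iff (definable_and (dg a) (dh b)) => rho i.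
by split=> [[-> ->]|[]].
Qed.

(** A finite case distinction on the label of the current position. *)
Lemma definable_with (A : finType) (g : forall rho : word, pos rho -> A)
    (P : A -> forall rho : word, pos rho -> Prop) :
  definable_map g -> (forall a, definable (P a)) ->
  definable (fun rho i => P (g rho i) rho i).
Proof.
move=> dg dP; have := definable_exists (fun a => definable_and (dg a) (dP a)).
by apply: definable_iff => rho i; split=> [[a [-> ]]|]; last by exists (g rho i).
Qed.

Lemma definable_last : definable (fun rho i => i = tw_last rho :> nat).
Proof.
exists (FNot (FUntil itv_full (FTrue Sigma) (FTrue Sigma))) => rho i /=; split.
  move=> nx; apply/eqP; rewrite eqn_leq -ltnS ltn_ord /= leqNgt.
  apply/negP => lti; apply: nx; exists ord_max; split=> //.
  by apply: itv_fullP; rewrite subr_ge0; apply: tw_time_mono; apply: ltnW.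
by move=> e [j [ij _ _ _]]; have := ltn_ord j; lia.
Qed.

(** * Automaton runs expressed by rational modalities *)

Section Runs.
Variables (A Q : finType) (g : forall rho : word, pos rho -> A).
Variable delta : Q -> A -> Q.
Hypothesis dg : definable_map g.

(** Kleene's theorem yields an expression for the words leading from [q] to [q']. Letters are
    replaced by their ranks, because [FFRat] indexes its formulas by ordinals; letter [k] stands for
    a formula defining the label [enum_val k]. *)
Lemma definable_run_until J P q q' : definable P ->
  definable (fun rho i => exists j : pos rho,
    [/\ i < j, P rho j, (tw_time j - tw_time i)%R \in itv_of R J &
      foldl delta q (map (@g rho) (positions rho i.+1 j)) = q']).
Proof.
move=> [phi phiP]; have [f fP] := choice dg.
have [r rP] := kleene (fun p (k : 'I_#|A|) => delta p (enum_val k)) q q'.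
exists (FFRat J (fun k : 'I_#|A| => f (enum_val k)) r phi) => rho i.
(* Every position carries exactly one label, so a word whose formulas hold along the factor can only
   be the sequence of its labels. *)
have readsE w p : reads (fun (k : 'I_#|A|) n =>
      frat_sat (f (enum_val k)) (inord n : pos rho)) w p <->
    map enum_val w = map (@g rho) (map inord (iota p (size w))).
  elim: w p => [|k w IH] p //=; rewrite IH fP.
  by split=> [[-> ->]|[-> ->]].
rewrite frat_sat_FRat; split=> -[j []].
  rewrite phiP => ij Pj Jj [w [sw /readsE wE /rP <-]].
  by exists j; split=> //; rewrite -(foldl_map delta enum_val) wE sw.
move=> ij Pj Jj e; exists j; split=> //; first exact/phiP.
have wE : [seq enum_val k | k <-
    [seq enum_rank (g i0) | i0 <- positions rho i.+1 j]] =
    map (@g rho) (positions rho i.+1 j).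
  by rewrite -map_comp; apply: eq_map => k /=; rewrite enum_rankK.
exists [seq enum_rank (g i0) | i0 <- positions rho i.+1 j]; split.
- by rewrite !size_map size_iota.
- by apply/readsE; rewrite wE !size_map size_iota.
- by apply/rP; rewrite -(foldl_map delta enum_val) wE.
Qed.

(** A rational modality reads only the positions strictly between its two ends. The run is therefore
    followed up to the last position, whose own letter is read by [lastF]; if [i] is itself last,
    nothing is left to read and [q] is tested directly. *)
Lemma definable_run_to_end (F : pred Q) q :
  definable (fun rho i => F (foldl delta q (map (@g rho) (positions_from rho i.+1)))).
Proof.
pose lastF q' := fun (rho : word) (i : pos rho) =>
  i = tw_last rho :> nat /\ F (delta q' (@g rho i)).
have dlast q' : definable (lastF q').
  apply: definable_and definable_last _.
  by apply: (definable_with (P := fun a _ _ => F (delta q' a))) => // a; apply: definable_const.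
have := definable_or (definable_and definable_last (definable_const (F q)))
  (definable_exists (fun q' => definable_run_until itv_full q q' (dlast q'))).
apply: definable_iff => rho i; have [e|ne] := eqVneq (i : nat) (tw_last rho).
  rewrite /positions_from /positions e subnn /=; split; last by left.
  by case=> [[]|[q' [j [ij _]]]] //; have := ltn_ord j; lia.
have lti : i < tw_last rho by have := ltn_ord i; lia.
pose l : pos rho := ord_max.
have -> : positions_from rho i.+1 = positions rho i.+1 l ++ [:: l].
  rewrite /positions_from (@positions_cat _ _ _ _ l) /=; last by rewrite lti leqnSn.
  by congr (_ ++ _); rewrite (@positions_cons _ _ _ l) // /positions subnn.
rewrite map_cat foldl_cat; split.
  case=> [[e]|[q' [j [ij [ej Fj] _ e]]]]; first by rewrite e eqxx in ne.
  have -> : l = j by apply: val_inj.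
  by rewrite e.
move=> Fl; right; eexists; exists l; split; [exact: lti | | |reflexivity] => //.
by apply: itv_fullP; rewrite subr_ge0; apply: tw_time_mono; apply: ltnW.
Qed.

End Runs.
End Definable.

(** * From the second-order logic to the temporal logic *)

Section MSOtoFRat.
Variables (R : realType) (Sigma : finType).
Local Notation word := (timed_word R Sigma).

(** A label, then one bit per first-order variable marking its position, then one bit per
    second-order variable recording membership. *)
Definition letter (A : Type) (n m : nat) : Type :=
  (A * (n.+1.-tuple bool * m.-tuple bool))%type.

Definition encode (A : Type) (g : forall rho : word, pos rho -> A) (rho : word)
    n m (t : n.+1.-tuple (pos rho)) (T : m.-tuple {set pos rho}) (i : pos rho) :
    letter A n m :=
  (g rho i, (map_tuple (eq_op^~ i) t, map_tuple (fun X : {set pos rho} => i \in X) T)).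

Definition encode_suffix (A : Type) (g : forall rho : word, pos rho -> A)
    (rho : word) n m (t : n.+1.-tuple (pos rho)) (T : m.-tuple {set pos rho}) :=
  map (encode g t T) (positions_from rho (tnth t ord0)).

(** Preserved by the quantifiers of the logic, this guarantees that the suffix from the anchor
    contains the marks of all first-order variables. *)
Definition anchored (rho : word) n (t : n.+1.-tuple (pos rho)) : Prop :=
  forall p, tnth t ord0 <= tnth t p.

(** The alphabet [A] and its labelling depend on the formula: they record the truth of the atoms
    that the variable bits do not determine. *)
Definition regular_mso k n m (phi : mso Sigma k n m) : Prop :=
  exists (A : finType) (g : forall rho : word, pos rho -> A),
    definable_map g /\
    exists2 L : seq (letter A n m) -> Prop, recognizable L &
      forall rho t T, @anchored rho n t ->
        mso_sat phi t T <-> L (encode_suffix g t T).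

Lemma encode_fo A (g : forall rho : word, pos rho -> A) rho n m
    (t : n.+1.-tuple (pos rho)) (T : m.-tuple {set pos rho}) i p :
  tnth (encode g t T i).2.1 p = (tnth t p == i).
Proof. by rewrite tnth_map. Qed.

Lemma encode_so A (g : forall rho : word, pos rho -> A) rho n m
    (t : n.+1.-tuple (pos rho)) (T : m.-tuple {set pos rho}) i X :
  tnth (encode g t T i).2.2 X = (i \in tnth T X).
Proof. by rewrite tnth_map. Qed.

(** An atom decided by the letter at the position of one variable: it suffices to look for the
    letter carrying that variable's mark, which anchoring places inside the suffix. *)
Lemma regular_mso_at k n m (phi : mso Sigma k n m) (p : 'I_n.+1)
    (A : finType) (g : forall rho : word, pos rho -> A)
    (f : letter A n m -> bool) :
  definable_map g ->
  (forall rho t T, @anchored rho n t ->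
     mso_sat phi t T <-> f (encode g t T (tnth t p))) ->
  regular_mso phi.
Proof.
move=> dg phiP; exists A, g; split=> //.
exists (fun w => has (fun x : letter A n m => tnth x.2.1 p && f x) w).
  exact: recognizable_has.
move=> rho t T tanch; rewrite phiP // has_positions_from; split.
  by move=> fp; exists (tnth t p); rewrite ?encode_fo ?eqxx.
by move=> [i _]; rewrite encode_fo => /andP[/eqP ->].
Qed.

Definition unlabelled (rho : word) (i : pos rho) : unit := tt.

Lemma definable_unlabelled : definable_map unlabelled.
Proof. by case; apply: definable_iff (definable_const _ _ True). Qed.

Lemma regular_MEq k n m p q : regular_mso (@MEq Sigma k n m p q).
Proof.
apply: (@regular_mso_at _ _ _ _ p _ _ (fun x => tnth x.2.1 q) definable_unlabelled).
by move=> rho t T _; rewrite encode_fo; split=> [->|/eqP].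
Qed.

Lemma regular_MSym k n m a p : regular_mso (@MSym Sigma k n m a p).
Proof.
have da : definable (fun (rho : word) i => a \in tw_sym i) by exists (FSym a).
apply: (@regular_mso_at _ _ _ _ p _ _ (fun x => x.1) (definable_map_bool da)).
by move=> rho t T _ /=; split=> /asboolP.
Qed.

Lemma regular_MIn k n m X p : regular_mso (@MIn Sigma k n m X p).
Proof.
apply: (@regular_mso_at _ _ _ _ p _ _ (fun x => tnth x.2.2 X) definable_unlabelled).
by move=> rho t T _; rewrite encode_so.
Qed.

Lemma regular_MTime k n m psi p :
  definable (fun (rho : word) i => tcf_sat (k := k) psi i) ->
  regular_mso (@MTime Sigma k n m psi p).
Proof.
move=> dpsi.
apply: (@regular_mso_at _ _ _ _ p _ _ (fun x => x.1) (definable_map_bool dpsi)).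
by move=> rho t T _ /=; split=> /asboolP.
Qed.

Lemma regular_MLt k n m p q : regular_mso (@MLt Sigma k n m p q).
Proof.
exists unit, unlabelled; split; first exact: definable_unlabelled.
exists (fun w => has_before (fun x : letter unit n m => tnth x.2.1 p)
                   (fun x => tnth x.2.1 q) w).
  exact: recognizable_has_before.
move=> rho t T tanch; rewrite has_before_positions_from; split.
  by move=> pq; exists (tnth t p), (tnth t q); rewrite !encode_fo !eqxx.
by move=> [i [j [_ ij]]]; rewrite !encode_fo /= => /eqP -> /eqP ->.
Qed.

Lemma regular_MNot k n m (phi : mso Sigma k n m) :
  regular_mso phi -> regular_mso (MNot phi).
Proof.
move=> [A [g [dg [L recL LP]]]]; exists A, g; split=> //.
exists (fun w => ~ L w); first exact: recognizable_not.
by move=> rho t T tanch /=; rewrite LP.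
Qed.

Lemma regular_MAnd k n m (phi phi' : mso Sigma k n m) :
  regular_mso phi -> regular_mso phi' -> regular_mso (MAnd phi phi').
Proof.
move=> [A [g [dg [L recL LP]]]] [A' [g' [dg' [L' recL' LP']]]].
exists (A * A')%type, (fun rho i => (g rho i, g' rho i)).
split; first exact: definable_map_pair.
pose left (x : letter (A * A') n m) : letter A n m := (x.1.1, x.2).
pose right (x : letter (A * A') n m) : letter A' n m := (x.1.2, x.2).
exists (fun w => L (map left w) /\ L' (map right w)).
  by apply: recognizable_and; apply: recognizable_map.
by move=> rho t T tanch /=; rewrite LP // LP' // /encode_suffix -!map_comp.
Qed.

(** The new set is a guessed track of bits, appended to the letters by [ext] and then projected
    away. *)
Lemma regular_MExSO k n m (phi : mso Sigma k n m.+1) :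
  regular_mso phi -> regular_mso (MExSO phi).
Proof.
move=> [A [g [dg [L recL LP]]]]; exists A, g; split=> //.
pose ext (x : letter A n m * bool) : letter A n m.+1 :=
  (x.1.1, (x.1.2.1, rcons_tuple x.1.2.2 x.2)).
exists (fun w => exists v, size v = size w /\ L (map ext (zip w v))).
  exact/(@recognizable_exists _ _ (fun w => L (map ext w)))/recognizable_map.
move=> rho t T tanch.
rewrite (@exists_column _ _ _ _ false (encode g t T) (fun w => L (map ext w)));
  last exact: positions_from_uniq.
have extE (X : {set pos rho}) i :
    encode g t (rcons_tuple T X) i = ext (encode g t T i, i \in X).
  by rewrite /encode /ext /=; congr (_, (_, _)); apply: val_inj; rewrite /= map_rcons.
split=> [[X /= /LP] -/(_ tanch) LX|[h Lh]].
  exists (fun i => i \in X); rewrite -map_comp.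
  by rewrite (eq_map (g := encode g t (rcons_tuple T X))).
exists [set i | h i]; apply/LP => //; rewrite /encode_suffix.
rewrite (eq_map (extE [set i | h i])).
rewrite -map_comp in Lh; rewrite (eq_map (g := ext \o (fun i => (encode g t T i, h i)))) //.
by move=> i /=; rewrite inE.
Qed.

(* A column of bits encodes the new variable when it has exactly one 1, lying
   after the anchor. *)
Lemma regular_MExFO k n m (phi : mso Sigma k n.+1 m) :
  regular_mso phi -> regular_mso (MExFO phi).
Proof.
move=> [A [g [dg [L recL LP]]]]; exists A, g; split=> //.
pose ext (x : letter A n m * bool) : letter A n.+1 m :=
  (x.1.1, (rcons_tuple x.1.2.1 x.2, x.1.2.2)).
pose K (w : seq (letter A n m * bool)) := L (map ext w) /\
  (~ has_before snd snd w /\ has_before (fun x => tnth x.1.2.1 ord0) snd w).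
exists (fun w => exists v, size v = size w /\ K (zip w v)).
  apply: (@recognizable_exists _ _ K); apply: recognizable_and.
    exact: recognizable_map.
  apply: recognizable_and; last exact: recognizable_has_before.
  by apply: recognizable_not; apply: recognizable_has_before.
move=> rho t T tanch.
rewrite (@exists_column _ _ _ _ false (encode g t T) K);
  last exact: positions_from_uniq.
have extE a i : encode g (rcons_tuple t a) T i = ext (encode g t T i, a == i).
  by rewrite /encode /ext /=; congr (_, (_, _)); apply: val_inj; rewrite /= map_rcons.
have anch (a : pos rho) : tnth t ord0 < a -> anchored (rcons_tuple t a).
  move=> ta p; rewrite tnth_rcons0.
  case: (unliftP ord_max p) => [p'|] ->; last by rewrite tnth_rcons_max ltnW.
  have -> : lift ord_max p' = widen_ord (leqnSn n.+1) p'.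
    by apply: val_inj; rewrite /= /bump leqNgt ltn_ord.
  by rewrite tnth_rcons_widen.
rewrite /K; split=> [[a [ta /LP]] -/(_ (anch _ ta)) La|].
  exists (fun i => a == i); split.
    rewrite -map_comp; move: La; rewrite /encode_suffix tnth_rcons0.
    by rewrite (eq_map (extE a)).
  split; last first.
    by apply/has_before_positions_from; exists (tnth t ord0), a; rewrite encode_fo !eqxx.
  by move=> /has_before_positions_from[i [j [_ ij /eqP ei /eqP ej]]]; rewrite -ei -ej ltnn in ij.
move=> [h [Lh [/has_before_positions_from uniq /has_before_positions_from ex]]].
case: ex => i [a [_ ia]]; rewrite encode_fo => /eqP ei ha.
have ta : tnth t ord0 < a by rewrite ei.
exists a; split=> //; apply/LP; first exact: anch.
rewrite /encode_suffix tnth_rcons0 (eq_map (extE a)).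
(* On the suffix the guessed column must be the indicator of [a]: a second 1, on either side of [a],
   would contradict uniqueness. *)
rewrite -map_comp in Lh; suff/eq_in_map -> :
  {in positions_from rho (tnth t ord0), (fun i => ext (encode g t T i, a == i)) =1
    ext \o (fun i => (encode g t T i, h i))} by [].
move=> j; rewrite mem_positions_from => tj /=; congr (ext (_, _)).
have [<-//|ne] := eqVneq a j; apply/esym/negbTE/negP => hj; apply: uniq.
have [aj|ja|e] := ltngtP a j.
- by exists a, j; split=> //; apply: ltnW.
- by exists j, a; split.
- by rewrite (val_inj e) eqxx in ne.
Qed.

(** Away from the marked positions all variable bits vanish, so the run there depends on the labels
    alone and falls under the lemmas on runs. *)
Lemma map_encode_off A (g : forall rho : word, pos rho -> A) (rho : word) n
    (t : n.+1.-tuple (pos rho)) (s : seq (pos rho)) :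
  (forall j, j \in s -> j \notin t) ->
  map (encode g t [tuple]) s =
  [seq (a, (nseq_tuple n.+1 false, [tuple])) | a <- map (g rho) s].
Proof.
move=> soff; rewrite -map_comp; apply/eq_in_map => j /soff jt /=.
congr (_, (_, _)); last by rewrite [LHS]tuple0.
apply: eq_from_tnth => p; rewrite tnth_map tnth_nseq.
by apply/negbTE; apply: contra jt => /eqP <-; apply: mem_tnth.
Qed.

(** Only the first letter of the suffix is marked. It is read by hand, by cases on its label, and
    the rest is an unmarked run to the end. *)
Lemma definable_unary k (phi : mso Sigma k 0 0) : regular_mso phi ->
  definable (fun (rho : word) i => mso_sat phi (cons_tuple i [tuple]) [tuple]).
Proof.
move=> [A [g [dg [L [Q [d [q0 [F FP]]]] LP]]]].
have := definable_with dg (fun a =>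
  definable_run_to_end (fun q b => d q (b, (nseq_tuple 1 false, [tuple]))) dg F
    (d q0 (a, ([tuple true], [tuple])))).
apply: definable_iff => rho i; rewrite LP; last by move=> p; rewrite (ord1 p).
rewrite FP /encode_suffix /positions_from tnth0 positions_cons //=.
rewrite map_encode_off ?foldl_map; last first.
  by move=> j; rewrite mem_positions // !inE -?val_eqE /=; lia.
suff -> : encode g (cons_tuple i [tuple]) [tuple] i = (g rho i, ([tuple true], [tuple])).
  by [].
by congr (_, (_, _)); apply: val_inj; rewrite //= eqxx.
Qed.

(** If the two variables coincide, one letter carries both marks and the window condition is that 0
    lies in [J]. Otherwise two marked letters separate two unmarked factors, and the state [q]
    reached just before the second mark is chosen by a finite disjunction. *)
Lemma definable_binary k (phi : mso Sigma k 1 0) J : regular_mso phi ->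
  definable (fun (rho : word) i => exists a, in_window i J a /\
    mso_sat phi (cons_tuple i (cons_tuple a [tuple])) [tuple]).
Proof.
move=> [A [g [dg [L [Q [d [q0 [F FP]]]] LP]]]].
pose e q a := d q (a, (nseq_tuple 2 false, [tuple])).
have satE (rho : word) (i a : pos rho) : i <= a ->
    mso_sat phi (cons_tuple i (cons_tuple a [tuple])) [tuple] <->
    F (foldl d q0 (map (encode g (cons_tuple i (cons_tuple a [tuple])) [tuple])
         (positions_from rho i))).
  move=> ia; rewrite LP ?FP //.
  by move=> [[|[|//]] lt]; rewrite !(tnth_nth i).
have encodeE (rho : word) (i a j : pos rho) :
    encode g (cons_tuple i (cons_tuple a [tuple])) [tuple] j =
    (g rho j, ([tuple i == j; a == j], [tuple])).
  by congr (_, (_, _)); apply: val_inj.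
have d_same : definable (fun rho i =>
    F (foldl e (d q0 (g rho i, ([tuple true; true], [tuple])))
         (map (g rho) (positions_from rho i.+1)))).
  exact: (definable_with dg (fun a => definable_run_to_end e dg F
    (d q0 (a, ([tuple true; true], [tuple]))))).
have d_end q : definable (fun rho i =>
    F (foldl e (d q (g rho i, ([tuple false; true], [tuple])))
         (map (g rho) (positions_from rho i.+1)))).
  exact: (definable_with dg (fun a => definable_run_to_end e dg F
    (d q (a, ([tuple false; true], [tuple]))))).
have d_after := definable_exists (fun q => definable_with dg (fun a =>
  definable_run_until e dg J (d q0 (a, ([tuple true; false], [tuple]))) q (d_end q))).
have := definable_or (definable_and (definable_const _ _ (0%R \in itv_of R J)) d_same)
  d_after.
apply: definable_iff => rho i.
have sameE : mso_sat phi (cons_tuple i (cons_tuple i [tuple])) [tuple] <->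
    F (foldl e (d q0 (g rho i, ([tuple true; true], [tuple])))
         (map (g rho) (positions_from rho i.+1))).
  rewrite satE // {1}/positions_from positions_cons //= encodeE eqxx.
  rewrite map_encode_off ?foldl_map // => j.
  by rewrite mem_positions // !inE -?val_eqE /=; lia.
have afterE (a : pos rho) : i < a ->
    mso_sat phi (cons_tuple i (cons_tuple a [tuple])) [tuple] <->
    F (foldl e (d (foldl e (d q0 (g rho i, ([tuple true; false], [tuple])))
                    (map (g rho) (positions rho i.+1 a)))
                  (g rho a, ([tuple false; true], [tuple])))
         (map (g rho) (positions_from rho a.+1))).
  move=> ia; have la : a <= (tw_last rho).+1 := ltnW (ltn_ord a).
  rewrite satE ?(ltnW ia) // {1}/positions_from positions_cons //=.
  rewrite (@positions_cat _ _ _ _ a) ?ia //.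
  rewrite (@positions_cons _ _ _ a) // map_cat foldl_cat /= !encodeE eqxx.
  rewrite !map_encode_off ?foldl_map; last first.
  - by move=> j; rewrite mem_positions // !inE -?val_eqE /=; lia.
  - by move=> j; rewrite mem_positions // !inE -?val_eqE /=; lia.
  suff [-> ->] : (a == i) = false /\ (i == a) = false by rewrite !eqxx.
  by rewrite [a == i]eq_sym; split; apply/negbTE; rewrite -val_eqE /= ltn_eqF.
split.
  case=> [[J0 /sameE Fi]|[q [a [ia Fa Ja eq]]]].
    by exists i; split=> //; split; rewrite ?subrr.
  exists a; split; first by split; rewrite // ltnW.
  by apply/afterE => //; rewrite eq.
move=> [a [[ia Ja] sat]]; case: (ltngtP i a) ia => // [ia|ia] _.
  by right; eexists; exists a; split; [| exact/afterE| |reflexivity].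
left; have ea := val_inj ia; subst a; rewrite subrr in Ja.
by split=> //; apply/sameE.
Qed.

End MSOtoFRat.

Lemma mso_regular (R : realType) (Sigma : finType) :
  (forall n m (phi : mso Sigma 2 n m), regular_mso R phi) /\
  (forall psi : tcf Sigma 2,
     definable (fun (rho : timed_word R Sigma) i => tcf_sat psi i)).
Proof.
apply: mso_tcf_ind => [n m p q|n m p q|n m a p|n m X p|n m phi H phi' H'|
  n m phi H|n m phi H|n m phi H|n m psi H p|j ltj Qs phi H].
- exact: regular_MEq.
- exact: regular_MLt.
- exact: regular_MSym.
- exact: regular_MIn.
- exact: regular_MAnd.
- exact: regular_MNot.
- exact: regular_MExFO.
- exact: regular_MExSO.
- exact: regular_MTime.
(* This is where [k = 2] enters: at most one timed quantifier precedes the formula. A universal one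
   is treated as a negated existential. *)
case: j ltj Qs phi H => [|[|//]] ltj Qs phi H; first exact: definable_unary.
rewrite /=; case: (thead Qs) => J; first exact: definable_binary.
have := definable_not (definable_binary J (regular_MNot H)).
apply: definable_iff => rho i; split=> [nex a ia|all [a [ia na]]].
  by apply: contrapT => na; apply: nex; exists a.
exact/na/all.
Qed.

(** * From the temporal logic to the second-order logic *)

Section Matches.
Variables (A : Type) (S : A -> nat -> Prop).

(** The factor occupies [p] up to but excluding [q], so that consecutive factors share an end
    point. *)
Definition matches (r : regexp A) (p q : nat) : Prop :=
  exists w, [/\ p + size w = q, reads S w p & re_lang r w].

Lemma reads_cat u v p : reads S (u ++ v) p <-> reads S u p /\ reads S v (p + size u).
Proof.
elim: u p => [|a u IH] p /=; first by rewrite addn0; split=> [|[]].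
by rewrite IH addSnnS; split=> [[? [? ?]]|[[? ?] ?]].
Qed.

Lemma matches_leq r p q : matches r p q -> p <= q.
Proof. by move=> [w [<- _ _]]; rewrite leq_addr. Qed.

Lemma matches_void p q : ~ matches (RVoid A) p q.
Proof. by move=> [w [_ _ /re_void]]. Qed.

Lemma matches_eps p q : matches (REps A) p q <-> p = q.
Proof.
split=> [[w [<- _ /re_eps ->]]|->]; first by rewrite addn0.
by exists [::]; split; rewrite ?addn0 //; constructor.
Qed.

Lemma matches_atom a p q : matches (RAtom a) p q <-> q = p.+1 /\ S a p.
Proof.
split=> [[w [e]]|[-> Sa]].
  by move=> + /re_atom ew; rewrite ew /= addn1 in e * => -[Sa _].
by exists [:: a]; split; rewrite ?addn1 //; constructor.
Qed.

Lemma matches_alt r s p q :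
  matches (RAlt r s) p q <-> matches r p q \/ matches s p q.
Proof.
split=> [[w [e rw /re_alt[]]]|[] [w [e rw ?]]]; [left|right| |]; exists w; split=> //.
  exact: LAltL.
exact: LAltR.
Qed.

Lemma matches_cat r s p q :
  matches (RCat r s) p q <-> exists c, matches r p c /\ matches s c q.
Proof.
split=> [[w [e + /re_cat[u [v [ew ru sv]]]]]|].
  rewrite ew reads_cat => -[hu hv]; rewrite ew size_cat addnA in e.
  by exists (p + size u); split; [exists u | exists v].
move=> [c [[u [<- hu ru]] [v [<- hv sv]]]]; exists (u ++ v).
by split; [rewrite size_cat addnA | apply/reads_cat | apply: LCat].
Qed.

Lemma matches_star0 r p : matches (RStar r) p p.
Proof. by exists [::]; split; rewrite ?addn0 //; constructor. Qed.

Lemma matches_starS r p c q : matches r p c -> matches (RStar r) c q ->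
  matches (RStar r) p q.
Proof.
move=> [u [<- hu ru]] [v [<- hv sv]]; exists (u ++ v).
by split; [rewrite size_cat addnA | apply/reads_cat | apply: LStarS].
Qed.

End Matches.

(* The set X collects the cut points of a factorization into nonempty factors. *)
Lemma matches_star (R : realType) (Sigma : finType) (rho : timed_word R Sigma)
    (A : Type) (S : A -> nat -> Prop) r (p q : pos rho) :
  matches S (RStar r) p q <->
  p <= q /\ exists X : {set pos rho}, [/\ p \in X, q \in X &
    forall c d, c \in X -> d \in X -> p <= c -> c < d -> d <= q ->
      (forall e, e \in X -> ~~ (c < e < d)) -> matches S r c d].
Proof.
split=> [m|[pq [X [pX qX HX]]]]; last first.
  have [n] := ubnP (q - p); elim: n p pq pX HX => // n IH p pq pX HX ltn.
  have [e|ne] := eqVneq p q; first by rewrite e; apply: matches_star0.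
  have ltpq : p < q by rewrite ltn_neqAle pq andbT.
  have qP : (q \in X) && (p < q) by rewrite qX.
  (* The first factor ends at the least cut point after [p]; the induction on the distance to [q]
     handles the others. *)
  case: (@arg_minnP _ q (fun c => (c \in X) && (p < c)) (@nat_of_ord _) qP).
  move=> c /andP[cX pc] cmin.
  have cq : c <= q by apply: cmin.
  apply: (@matches_starS _ _ _ _ c).
    apply: HX => // e eX; apply/negP => /andP[pe ec].
    by have := cmin e; rewrite eX pe => /(_ isT); lia.
  apply: IH => //; last by lia.
  by move=> c' d' c'X d'X cc' c'd' d'q; apply: HX => //; lia.
split; first exact: matches_leq m.
case: m => w [e hw sw]; elim/re_star_ind: w / sw p hw e => [|u v ru sv IH] p hw e.
  have epq : p = q by apply: val_inj; rewrite /= -e addn0.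
  exists [set p]; rewrite epq !inE; split=> // c d; rewrite !inE => /eqP -> /eqP ->.
  by rewrite ltnn.
move: hw; rewrite reads_cat => -[hu hv]; rewrite size_cat addnA in e.
(* An empty factor adds no cut point and is skipped. *)
have [u0|un0] := eqVneq (size u) 0.
  by apply: IH; rewrite u0 addn0 in hv e.
have ltc : p + size u < (tw_last rho).+1 by have := ltn_ord q; lia.
pose c : pos rho := Ordinal ltc.
have [X [cX qX HX]] := IH c hv e.
(* The set given by induction may contain stray positions below [c]; discarding them makes [c] the
   cut point that follows [p]. *)
exists (p |: [set x in X | c <= x]); split; first by rewrite !inE eqxx.
  by rewrite !inE qX; apply/orP; right; rewrite /= -e leq_addr.
have pc : p < c by rewrite /=; lia.
move=> c' d'; rewrite !inE => c'X /orP[/eqP -> pc' c'p|/andP[d'X cd'] pc' c'd' d'q sep].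
  by lia.
case/orP: c'X => [/eqP ec'|/andP[c'X cc']].
  have -> : d' = c.
    apply/val_inj/eqP; rewrite eqn_leq cd' andbT leqNgt; apply/negP => ltcd.
    by have := sep c; rewrite !inE cX leqnn orbT ec' pc ltcd => /(_ isT).
  by rewrite ec'; exists u.
apply: HX => // x xX; apply/negP => /andP[c'x xd'].
have := sep x; rewrite !inE xX c'x xd' (leq_trans cc' (ltnW c'x)) orbT.
by move=> /(_ isT).
Qed.

(** * Derived connectives of the second-order logic *)

Section DerivedConnectives.
Variables (Sigma : finType) (k : nat).

Definition MOr n m (phi psi : mso Sigma k n m) := MNot (MAnd (MNot phi) (MNot psi)).
Definition MImp n m (phi psi : mso Sigma k n m) := MNot (MAnd phi (MNot psi)).
Definition MAll n m (phi : mso Sigma k n.+1 m) := MNot (MExFO (MNot phi)).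

Variables (R : realType) (rho : timed_word R Sigma) (n m : nat).
Implicit Types (t : n.+1.-tuple (pos rho)) (T : m.-tuple {set pos rho}).

Lemma mso_sat_MOr (phi psi : mso Sigma k n m) t T :
  mso_sat (MOr phi psi) t T <-> mso_sat phi t T \/ mso_sat psi t T.
Proof. by rewrite /= not_andE !notE. Qed.

Lemma mso_sat_MImp (phi psi : mso Sigma k n m) t T :
  mso_sat (MImp phi psi) t T <-> (mso_sat phi t T -> mso_sat psi t T).
Proof.
split=> /= [H a|H [a b]]; last exact/b/H.
by apply: contrapT => b; apply: H.
Qed.

Lemma mso_sat_MAll (phi : mso Sigma k n.+1 m) t T :
  mso_sat (MAll phi) t T <->
  forall a : pos rho, tnth t ord0 < a -> mso_sat phi (rcons_tuple t a) T.
Proof.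
split=> /= [H a ta|H [a [ta na]]]; last exact/na/H.
by apply: contrapT => na; apply: H; exists a.
Qed.

End DerivedConnectives.

(** With de Bruijn levels, binding a variable keeps the numbers of the earlier ones and gives the
    greatest number to the bound one. *)
Definition old n (p : 'I_n) : 'I_n.+1 := widen_ord (leqnSn n) p.
Definition new n : 'I_n.+1 := ord_max.

Definition tnth_rconsE :=
  (tnth_rcons0, (fun T n t a p => @tnth_rcons_widen T n t a p : tnth _ (old p) = _),
   (fun T n t a => @tnth_rcons_max T n t a : tnth _ (new n) = _)).

Section FRatToMSO.
Variables (R : realType) (Sigma : finType).
Local Notation word := (timed_word R Sigma).

Definition expressible (phi : fratmtl Sigma) : Prop :=
  exists psi : tcf Sigma 2, forall (rho : word) (i : pos rho),
    tcf_sat psi i <-> frat_sat phi i.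

(** By induction on [r], in every context since quantifiers enlarge it. First-order quantifiers
    reach only positions after the anchor; as [p] lies strictly after it, so does every cut point
    from [p] on. *)
Lemma mso_matches N (F : 'I_N -> fratmtl Sigma) (r : regexp 'I_N) n m
    (p q : 'I_n.+1) :
  (forall a, expressible (F a)) ->
  exists phi : mso Sigma 2 n m, forall (rho : word) (t : n.+1.-tuple (pos rho)) T,
    tnth t ord0 < tnth t p ->
    mso_sat phi t T <->
    matches (fun a k => frat_sat (F a) (inord k : pos rho)) r (tnth t p) (tnth t q).
Proof.
move=> Fexp; elim: r n m p q => [||a|r IHr s IHs|r IHr s IHs|r IHr] n m p q.
- exists (MNot (MEq Sigma 2 m p p)) => rho t T _ /=.
  by split=> [|/matches_void] //.
- exists (MEq Sigma 2 m p q) => rho t T _ /=; rewrite matches_eps.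
  by split=> [->|/val_inj].
- have [psi psiP] := Fexp a.
  exists (MAnd (MAnd (MLt Sigma 2 m p q)
      (MNot (MExFO (MAnd (MLt Sigma 2 m (old p) (new _)) (MLt Sigma 2 m (new _) (old q))))))
    (MTime m psi p)) => rho t T tp /=.
  rewrite psiP matches_atom inord_val; split=> [[[pq nb] Sa]|[e Sa]]; split=> //.
    apply/eqP; rewrite eqn_leq pq andbT leqNgt; apply/negP => ltq.
    have lt : (tnth t p).+1 < (tw_last rho).+1.
      exact: ltn_trans ltq (ltn_ord _).
    by apply: nb; exists (Ordinal lt); rewrite !tnth_rconsE /=; split; [lia|].
  split; first by rewrite e.
  by move=> [c]; rewrite !tnth_rconsE e => -[_ [pc]]; lia.
- have [phi phiP] := IHr n m p q; have [psi psiP] := IHs n m p q.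
  exists (MOr phi psi) => rho t T tp.
  by rewrite mso_sat_MOr phiP // psiP // matches_alt.
- have [phi phiP] := IHr n.+1 m (old p) (new _).
  have [psi psiP] := IHs n.+1 m (new _) (old q).
  exists (MExFO (MAnd phi psi)) => rho t T tp; rewrite matches_cat /=; split.
    move=> [c [tc []]]; rewrite phiP ?psiP ?tnth_rconsE //.
    by exists c.
  move=> [c [rc sc]].
  have lt : c < (tw_last rho).+1.
    exact: leq_ltn_trans (matches_leq sc) (ltn_ord _).
  have tc : tnth t ord0 < Ordinal lt.
    exact: leq_trans tp (matches_leq rc).
  by exists (Ordinal lt); rewrite phiP ?psiP ?tnth_rconsE.
- have [phi phiP] := IHr n.+2 m.+1 (old (new _)) (new _).
  pose lt N (x y : 'I_N.+1) := MLt Sigma 2 m.+1 x y.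
  pose mem N (x : 'I_N.+1) := MIn Sigma 2 (new m) x.
  (* The variables [c] and [d] are the two universally quantified positions; [cuts] makes them
     consecutive elements of the guessed set between [p] and [q], and [phi] then matches [r] on the
     factor from [c] to [d]. *)
  pose c := old (new n.+1); pose d := new n.+2.
  pose between := MExFO (MAnd (mem _ (new n.+3))
    (MAnd (lt _ (old c) (new n.+3)) (lt _ (new n.+3) (old d)))).
  pose cuts := MAnd (MAnd (MAnd (mem _ c) (mem _ d))
    (MAnd (MNot (lt _ c (old (old p)))) (MAnd (lt _ c d) (MNot (lt _ (old (old q)) d)))))
    (MNot between).
  exists (MAnd (MNot (MLt Sigma 2 m q p)) (MExSO (MAnd (MAnd (mem _ p) (mem _ q))
    (MAll (MAll (MImp cuts phi)))))) => rho t T tp.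
  have betweenE X (x y : pos rho) :
      mso_sat between (rcons_tuple (rcons_tuple t x) y) (rcons_tuple T X) <->
      exists e : pos rho, [/\ tnth t ord0 < e, e \in X, x < e & e < y].
    rewrite /=; split=> -[e]; rewrite !tnth_rconsE => -[te].
      by move=> [eX [xe ey]]; exists e.
    by move=> eX xe ey; exists e; rewrite !tnth_rconsE.
  have cutsE X (x y : pos rho) :
      mso_sat cuts (rcons_tuple (rcons_tuple t x) y) (rcons_tuple T X) <->
      [/\ x \in X, y \in X, tnth t p <= x, x < y & y <= tnth t q] /\
      ~ exists e : pos rho, [/\ tnth t ord0 < e, e \in X, x < e & e < y].
    rewrite -betweenE; split=> -[H nb]; split=> //.
      move: H; rewrite /= !tnth_rconsE.
      by move=> [[xX yX] [/negP px [xy /negP yq]]]; split=> //; rewrite leqNgt.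
    case: H => xX yX px xy yq; rewrite /= !tnth_rconsE.
    split=> //; split; first by apply/negP; rewrite -leqNgt.
    by split=> //; apply/negP; rewrite -leqNgt.
  rewrite matches_star; split=> -[pq [X]].
    move=> [pqX /(mso_sat_MAll (MAll (MImp cuts phi))) H].
    move: pqX; rewrite /= !tnth_rconsE => -[pX qX].
    split; first by rewrite leqNgt; apply/negP.
    exists X; split=> // x y xX yX px xy yq sep.
    have tx : tnth t ord0 < x by apply: leq_trans tp px.
    have ty : tnth t ord0 < y by apply: ltn_trans tx xy.
    have /mso_sat_MAll := H x tx; move=> /(_ y); rewrite tnth_rcons0 => /(_ ty).
    rewrite mso_sat_MImp cutsE phiP !tnth_rconsE //; apply; split=> //.
    by move=> [e [_ eX xe ey]]; have := sep e eX; rewrite xe ey.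
  move=> [pX qX H]; split; first by apply/negP; rewrite -leqNgt.
  exists X; split; first by rewrite /= !tnth_rconsE.
  apply/mso_sat_MAll => x tx; apply/mso_sat_MAll => y; rewrite tnth_rcons0 => ty.
  rewrite mso_sat_MImp cutsE phiP !tnth_rconsE // => -[[xX yX px xy yq] nb].
  apply: H => // e eX; apply/negP => /andP[xe ey]; apply: nb; exists e; split=> //.
  exact: ltn_trans tx xe.
Qed.

Definition tcf0 (phi : mso Sigma 2 0 0) : tcf Sigma 2 := TCF (isT : 0 < 2) [tuple] phi.
Definition tcf1 J (phi : mso Sigma 2 1 0) : tcf Sigma 2 :=
  TCF (isT : 1 < 2) [tuple TExists J] phi.

(** Subformulas are nested through [MTime], and the target of a timed modality is the single
    quantified variable [t_1] of a time-constraint formula. *)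
Lemma frat_expressible phi : expressible phi.
Proof.
elim: phi => [a||phi [psi psiP] phi' [psi' psiP']|phi [psi psiP]|
  J phi [psi psiP] phi' [psi' psiP']|J N F IHF r phi [psi psiP]].
- by exists (tcf0 (MSym 2 0 a ord0)).
- by exists (tcf0 (MEq Sigma 2 0 ord0 ord0)).
- exists (tcf0 (MAnd (MTime 0 psi ord0) (MTime 0 psi' ord0))) => rho i.
  by rewrite /= -psiP -psiP'.
- exists (tcf0 (MNot (MTime 0 psi ord0))) => rho i.
  by rewrite /= -psiP.
- pose guard := MImp (MLt Sigma 2 0 (new 2) (old (new 1))) (MTime 0 psi (new 2)).
  exists (tcf1 J (MAnd (MAnd (MLt Sigma 2 0 ord0 (new 1)) (MTime 0 psi' (new 1)))
    (MAll guard))) => rho i.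
  split=> -[j].
    move=> [[_ Jj] [[ij /psiP' sj] /(mso_sat_MAll guard) H]]; exists j; split=> // k /andP[ik kj].
    have /mso_sat_MImp := H [tuple] k ik; rewrite /= !tnth_rconsE psiP; exact.
  move=> [ij sj Jj H]; exists j; split; first by split=> //; apply: ltnW.
  split; first by split=> //; apply/psiP'.
  apply/mso_sat_MAll => k ik; apply/mso_sat_MImp; rewrite /= !tnth_rconsE psiP => kj.
  by apply: H; rewrite kj andbT.
- have [mphi mphiP] := mso_matches r 0 (new 2) (old (new 1)) IHF.
  (* The factor to be matched starts at [i.+1], named as the position after the anchor that has no
     other between; being strictly after the anchor, it meets the condition of [mso_matches]. *)
  exists (tcf1 J (MAnd (MAnd (MLt Sigma 2 0 ord0 (new 1)) (MTime 0 psi (new 1)))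
    (MExFO (MAnd (MNot (MExFO (MLt Sigma 2 0 (new _) (old (new _))))) mphi)))) => rho i.
  rewrite frat_sat_FRat; split=> -[j].
    move=> [[_ Jj] [[ij /psiP sj] [c [ic [first mc]]]]].
    have := mphiP rho (rcons_tuple (cons_tuple i (cons_tuple j [tuple])) c) [tuple].
    rewrite !tnth_rconsE => /(_ ic)/iffLR/(_ mc)[w [ew rw lw]].
    have ec : c = i.+1 :> nat.
      apply/eqP; rewrite eqn_leq [i < c]ic andbT leqNgt; apply/negP => ltc.
      have lt : i.+1 < (tw_last rho).+1 by apply: ltn_trans ltc (ltn_ord _).
      by apply: first; exists (Ordinal lt); rewrite /= !tnth_rconsE.
    rewrite ec in ew rw; exists j; split=> //; exists w; split=> //.
    by rewrite -[X in X - _](ew : _ = nat_of_ord j) addKn.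
  move=> [ij sj Jj [w [sw rw lw]]]; exists j; split; first by split=> //; apply: ltnW.
  split; first by split=> //; apply/psiP.
  have lt : i.+1 < (tw_last rho).+1 by apply: leq_ltn_trans ij (ltn_ord _).
  exists (Ordinal lt); split=> //; split.
    by move=> [e]; rewrite /= !tnth_rconsE /= => -[ie]; rewrite ltnS leqNgt ie.
  apply/mphiP; rewrite !tnth_rconsE //; exists w; split=> //.
  by rewrite sw; apply: subnKC.
Qed.

End FRatToMSO.

Theorem theorem5 (R : realType) (Sigma : finType) :
  (forall phi : fratmtl Sigma, exists psi : q2mso Sigma,
     tcf_lang R psi = frat_lang R phi) /\
  (forall psi : q2mso Sigma, exists phi : fratmtl Sigma,
     frat_lang R phi = tcf_lang R psi).
Proof.
split=> [phi|psi].
  have [psi psiP] := frat_expressible R phi; exists psi.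
  by apply/funext => rho; apply/propext; apply: psiP.
have [phi phiP] := (mso_regular R Sigma).2 psi; exists phi.
by apply/funext => rho; apply/propext; apply: phiP.
Qed.
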